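(* Let $P$ be a Borel probability law supported in $[0,1]$ with cumulative distribution function $F(y)=P((-\infty,y])$, let $(X_t)_{t\ge1}$ be i.i.d. with law $P$ (taking values in $[0,1]$), and let $\delta\in(0,1]$. Then with probability at least $1-\delta$, simultaneously for all integers $T\ge1$ and all $y\in[0,1]$, $$F(y)\in\left[\sup_{y_-\in[0,y]}\mathrm{kl}_-^{-1}\Big(\hat F_T(y_-),\tfrac1T\log\tfrac{2\sqrt T}{(y-y_-)\delta}\Big),\ \inf_{y_+\in[y,1]}\mathrm{kl}_+^{-1}\Big(\hat F_T(y_+),\tfrac1T\log\tfrac{2\sqrt T}{(y_+-y)\delta}\Big)\right].$$ Moreover, for all $T\ge1$ and $y\in[0,1]$, $$\inf_{y_+\in[y,1]}\mathrm{kl}_+^{-1}\Big(\hat F_T(y_+),\tfrac1T\log\tfrac{2\sqrt T}{(y_+-y)\delta}\Big)=\min_{t\in\{C_T(y),\dots,T\}}\mathrm{kl}_+^{-1}\Big(\tfrac tT,\tfrac1T\log\tfrac{2\sqrt T}{(X^{(T)}_{t+1}-y)\delta}\Big)$$ and $$\sup_{y_-\in[0,y]}\mathrm{kl}_-^{-1}\Big(\hat F_T(y_-),\tfrac1T\log\tfrac{2\sqrt T}{(y-y_-)\delta}\Big)=\max_{t\in\{0,\dots,C_T(y)\}}\mathrm{kl}_-^{-1}\Big(\tfrac tT,\tfrac1T\log\tfrac{2\sqrt T}{(y-X^{(T)}_t)\delta}\Big).$$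
   Context: For $T\ge1$ and $y\in[0,1]$: $C_T(y)$ is the number of $t\in\{1,\dots,T\}$ with $X_t\le y$, and $\hat F_T(y)=C_T(y)/T$ is the empirical CDF. $X^{(T)}_1\le\dots\le X^{(T)}_T$ denote the first $T$ observations sorted in non-decreasing order, and $X^{(T)}_0=0$, $X^{(T)}_{T+1}=1$. The binary relative entropy is $\mathrm{kl}(p,q)=p\log\frac pq+(1-p)\log\frac{1-p}{1-q}$ for $p,q\in(0,1)$, with $\mathrm{kl}(0,q)=\log\frac1{1-q}$ for $q\in[0,1)$, $\mathrm{kl}(1,q)=\log\frac1q$ for $q\in(0,1]$, $\mathrm{kl}(p,0)=+\infty$ for $p\in(0,1]$, and $\mathrm{kl}(p,1)=+\infty$ for $p\in[0,1)$. For $p\in[0,1]$ and $C\in[0,+\infty]$, $$\mathrm{kl}_+^{-1}(p,C)=\sup\{q\in[0,1]:\mathrm{kl}(p,q)\le C\},\qquad \mathrm{kl}_-^{-1}(p,C)=\inf\{q\in[0,1]:\mathrm{kl}(p,q)\le C\}.$$ Conventions: $1/0=+\infty$ and $\log(+\infty)=+\infty$. $\log$ is the natural logarithm. *)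

(* Defs.v *)
From HB Require Import structures.
From mathcomp Require Import all_boot all_order all_algebra.
From mathcomp Require Import all_classical all_reals all_analysis.

Set Implicit Arguments.
Unset Strict Implicit.
Unset Printing Implicit Defensive.

Import Order.TTheory GRing.Theory Num.Theory.
Import numFieldNormedType.Exports.

Local Open Scope classical_set_scope.
Local Open Scope ring_scope.

Definition mutually_independent d (Omega : measurableType d) (R : realType)
    (Pr : probability Omega R) (X : nat -> {RV Pr >-> R}) : Prop :=
  forall (J : seq nat) (A : nat -> set R),
    uniq J -> (forall i, i \in J -> measurable (A i)) ->
    Pr (\bigcap_(i in [set` J]) (X i @^-1` A i)) =
    (\prod_(i <- J) Pr (X i @^-1` A i))%E.

(* The values of non-measurable sets under a probability carry no meaning, so
   laws are compared on measurable sets only. *)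
Definition iid_with_law d (Omega : measurableType d) (R : realType)
    (Pr : probability Omega R) (P : probability R R)
    (X : nat -> {RV Pr >-> R}) : Prop :=
  mutually_independent X /\
  forall (t : nat) (A : set R),
    measurable A -> distribution Pr (X t) A = P A.

(* A realization of the observations is a sequence x : nat -> R indexed from 0:
   x t is the observation number t + 1, and the first T observations are
   x 0, ..., x (T - 1). *)

Definition emp_count (R : realType) (x : nat -> R) (T : nat) (y : R) : nat :=
  count (fun t => x t <= y) (iota 0 T).

Definition emp_cdf (R : realType) (x : nat -> R) (T : nat) (y : R) : R :=
  (emp_count x T y)%:R / T%:R.

(* Entry number k is 0 for k = 0, the k-th smallest of the first T observations
   for 1 <= k <= T, and 1 for k = T + 1. *)
Definition order_stat (R : realType) (x : nat -> R) (T k : nat) : R :=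
  nth 0 (0 :: rcons (sort <=%R [seq x t | t <- iota 0 T]) 1) k.

(* Only meaningful for p and q in [0, 1]. *)
Definition kl (R : realType) (p q : R) : \bar R :=
  if p == 0 then (if q == 1 then +oo%E else (ln (1 - q)^-1)%:E)
  else if p == 1 then (if q == 0 then +oo%E else (ln q^-1)%:E)
  else if (q == 0) || (q == 1) then +oo%E
  else (p * ln (p / q) + (1 - p) * ln ((1 - p) / (1 - q)))%:E.

Definition kl_inv_upper (R : realType) (p : R) (C : \bar R) : R :=
  sup [set q : R | 0 <= q <= 1 /\ (kl p q <= C)%E].

Definition kl_inv_lower (R : realType) (p : R) (C : \bar R) : R :=
  inf [set q : R | 0 <= q <= 1 /\ (kl p q <= C)%E].

(* (1/T) log (2 sqrt T / (h delta)), computed in the extended reals, where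
   0^-1 = +oo and lne +oo = +oo, so that it is +oo at h = 0. *)
Definition kl_level (R : realType) (delta : R) (T : nat) (h : R) : \bar R :=
  ((T%:R^-1)%:E * lne ((2 * Num.sqrt T%:R)%:E / (h * delta)%:E))%E.

Definition upper_band (R : realType) (delta : R) (x : nat -> R) (T : nat)
    (y : R) : R :=
  inf [set kl_inv_upper (emp_cdf x T z) (kl_level delta T (z - y))
      | z in `[y, 1]].

Definition lower_band (R : realType) (delta : R) (x : nat -> R) (T : nat)
    (y : R) : R :=
  sup [set kl_inv_lower (emp_cdf x T z) (kl_level delta T (y - z))
      | z in `[0, y]].

(* A minimum (maximum) over a nonempty finite range of indices is a bigop whose
   initial value is the term at one end of that range. *)
Definition upper_band_os (R : realType) (delta : R) (x : nat -> R) (T : nat)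
    (y : R) : R :=
  let f t := kl_inv_upper (t%:R / T%:R)
               (kl_level delta T (order_stat x T t.+1 - y)) in
  \big[Num.min/f T]_(emp_count x T y <= t < T.+1) f t.

Definition lower_band_os (R : realType) (delta : R) (x : nat -> R) (T : nat)
    (y : R) : R :=
  let f t := kl_inv_lower (t%:R / T%:R)
               (kl_level delta T (y - order_stat x T t)) in
  \big[Num.max/f 0%N]_(0 <= t < (emp_count x T y).+1) f t.

(* Main.v *)
Require Import Defs.
From HB Require Import structures.
From mathcomp Require Import all_boot all_order all_algebra.
From mathcomp Require Import all_classical all_reals all_analysis.
From mathcomp Require Import ring lra.

Set Implicit Arguments.
Unset Strict Implicit.
Unset Printing Implicit Defensive.

Import Order.TTheory GRing.Theory Num.Theory.
Import numFieldNormedType.Exports.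

Local Open Scope classical_set_scope.
Local Open Scope ring_scope.

(* For each threshold z the indicators of X_t <= z are i.i.d. Bernoulli(F(z)), so
   the ratio of the Krichevsky-Trofimov mixture to the true likelihood of the
   first T indicators is a nonnegative martingale with initial value 1, and it is
   at least exp(T kl(F_T(z), F(z))) / (2 sqrt T), F_T being the empirical CDF.
   Its average over z in [0, 1] is again such a martingale, and by Ville's
   inequality it stays below 1/delta with probability at least 1 - delta. If
   F_T(y+) < F(y) for some y+ > y, then kl(F_T(z), F(z)) >= kl(F_T(y+), F(y)) for
   all z in [y, y+] by monotonicity, so the average is at least
   (y+ - y) exp(T kl(F_T(y+), F(y))) / (2 sqrt T), which is the upper bound; the
   lower bound is symmetric.

   The average over z is replaced by the average over the grid {j/n}: the first
   T observations then only matter through a word over a finite alphabet, so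
   Ville's inequality is an induction on words and needs no conditional
   expectation. The good event is the limsup over n of the good events of the
   grids. *)

(** * The Krichevsky-Trofimov mixture *)

Lemma ger0_is_derive_homo (R : realType) (f df : R -> R) (a b : R) :
  a <= b ->
  (forall x, a <= x <= b -> is_derive x 1 f (df x)) ->
  (forall x, a <= x <= b -> 0 <= df x) -> f a <= f b.
Proof.
move=> ab fdf df0.
apply: (@ger0_derive1_le_cc _ f a b); rewrite ?in_itv/= ?lexx ?ab//.
- move=> x; rewrite in_itv/= => /andP[/ltW ax /ltW xb].
  by apply: ex_derive; apply: fdf; rewrite ax.
- move=> x; rewrite in_itv/= => /andP[/ltW ax /ltW xb].
  have xab : a <= x <= b by rewrite ax.
  by rewrite derive1E (@derive_val _ _ _ _ _ _ _ (fdf x xab)) df0.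
- apply: derivable_within_continuous => x; rewrite in_itv/= => xab.
  by apply: ex_derive; exact: fdf.
Qed.

Lemma is_derive_ln1D (R : realType) (x : R) : -1 < x ->
  is_derive x 1 (fun y => ln (1 + y)) (1 + x)^-1.
Proof.
move=> x1; have x0 : 0 < 1 + x by lra.
have h := is_derive1_ln x0.
have h2 : is_derive x 1 (fun y : R => 1 + y) (0 + 1 : R).
  exact: is_deriveD.
have := @is_derive1_comp _ (@ln R) (fun y : R => 1 + y) x _ _ h h2.
by rewrite add0r mulr1.
Qed.

Lemma is_derive_ln1B (R : realType) (x : R) : x < 1 ->
  is_derive x 1 (fun y => ln (1 - y)) (- (1 - x)^-1).
Proof.
move=> x1; have x0 : 0 < 1 - x by lra.
have h := is_derive1_ln x0.
have h2 : is_derive x 1 (fun y : R => 1 - y) (0 - 1 : R).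
  exact: is_deriveB.
have := @is_derive1_comp _ (@ln R) (fun y : R => 1 - y) x _ _ h h2.
by rewrite sub0r mulrN1.
Qed.

(** The difference of the two sides vanishes at 0 and has derivative 2x^2 / (1 - x^2). *)
Lemma ln_ratio_ge (R : realType) (s : R) : 0 <= s < 1 ->
  2 * s <= ln (1 + s) - ln (1 - s).
Proof.
move=> /andP[s0 s1].
pose f (x : R) := ln (1 + x) - ln (1 - x) - 2 * x.
suff : f 0 <= f s by rewrite /f addr0 subr0 ln1 mulr0; lra.
apply: (@ger0_is_derive_homo _ f
  (fun x => (1 + x)^-1 - (- (1 - x)^-1) - 2 * 1)) => // x /andP[x0 xs].
- have h1 := @is_derive_ln1D _ x ltac:(lra).
  have h2 := @is_derive_ln1B _ x ltac:(lra).
  apply: is_deriveB.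
- have -> : (1 + x)^-1 - (- (1 - x)^-1) - 2 * 1 = 2 * x ^+ 2 / ((1 + x) * (1 - x)).
    by field; apply/andP; split; apply/eqP; lra.
  by rewrite divr_ge0 ?mulr_ge0 ?sqr_ge0//; lra.
Qed.

(** Same method: the difference has derivative -ln(1 - x^2), which is nonnegative. *)
Lemma xlnx_diff_le (R : realType) (s : R) : 0 <= s < 1 ->
  (1 + s) * ln (1 + s) - (1 - s) * ln (1 - s) <= 2 * s.
Proof.
move=> /andP[s0 s1].
pose f (x : R) := 2 * x - ((1 + x) * ln (1 + x) - (1 - x) * ln (1 - x)).
suff : f 0 <= f s by rewrite /f addr0 subr0 ln1 mulr0; lra.
apply: (@ger0_is_derive_homo _ f
  (fun x => 2 * 1 - (((1 + x) * (1 + x)^-1 + ln (1 + x) * (0 + 1)) -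
    ((1 - x) * - (1 - x)^-1 + ln (1 - x) * (0 - 1))))) => // x /andP[x0 xs].
- have h1 := @is_derive_ln1D _ x ltac:(lra).
  have h2 := @is_derive_ln1B _ x ltac:(lra).
  have h3 : is_derive x 1 (fun y : R => 1 + y) (0 + 1 : R) by apply: is_deriveD.
  have h4 : is_derive x 1 (fun y : R => 1 - y) (0 - 1 : R) by apply: is_deriveB.
  have h5 := is_deriveB (is_deriveM h3 h1) (is_deriveM h4 h2).
  have h6 : is_derive x 1 (fun y : R => 2 * y) (2 * 1 : R) by apply: is_deriveZ.
  exact: (is_deriveB h6 h5).
- rewrite mulrN !divff; [|apply/eqP; lra..].
  rewrite add0r sub0r mulr1 mulrN1.
  suff : ln (1 + x) + ln (1 - x) <= 0 by lra.
  rewrite -lnM ?posrE; [|lra..].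
  by apply: ln_le0; nra.
Qed.

(* The Krichevsky-Trofimov probability of a word with [a] ones and [b] zeros:
   the integral of q^a (1 - q)^b against the Beta(1/2, 1/2) law of q. *)
Definition kt (R : realType) (a b : nat) : R :=
  (\prod_(i < a) (i%:R + 2^-1)) * (\prod_(i < b) (i%:R + 2^-1)) / (a + b)`!%:R.

Lemma kt_gt0 (R : realType) a b : 0 < kt R a b.
Proof.
have h n : 0 < \prod_(i < n) (i%:R + 2^-1) :> R.
  by apply: prodr_gt0 => i _; rewrite ltr_wpDl ?ler0n.
by rewrite /kt divr_gt0 ?mulr_gt0// ltr0n fact_gt0.
Qed.

Lemma ktC (R : realType) a b : kt R a b = kt R b a.
Proof. by rewrite /kt addnC [X in X / _]mulrC. Qed.

Lemma ktSr (R : realType) a b :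
  kt R a b.+1 = kt R a b * ((b%:R + 2^-1) / (a + b).+1%:R).
Proof.
rewrite /kt big_ord_recr/= addnS factS natrM.
have : (a + b).+1%:R != 0 :> R by rewrite pnatr_eq0.
have : (a + b)`!%:R != 0 :> R by rewrite pnatr_eq0 -lt0n fact_gt0.
move: (_.+1%:R) (_`!%:R) => u v u0 v0; field.
by rewrite u0 v0.
Qed.

(** The predictive probabilities (a + 1/2)/(a + b + 1) and (b + 1/2)/(a + b + 1) sum to 1; this
    makes the likelihood ratio a martingale. *)
Lemma ktD (R : realType) a b : kt R a.+1 b + kt R a b.+1 = kt R a b.
Proof.
rewrite ktC !ktSr (ktC _ b) (addnC b) -mulrDr -mulrDl.
rewrite (_ : _ + _ + _ = (a + b).+1%:R).
  by rewrite divff ?mulr1// pnatr_eq0.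
by rewrite -addn1 !natrD; field.
Qed.

(** With s = 1/(2x + 1) one has (x + 1)/x = (1 + s)/(1 - s) and x + 1/2 = 1/(2s), so the claim
    becomes [ln_ratio_ge]. *)
Lemma ln_succ_ge (R : realType) (x : R) : 1 <= x ->
  1 <= (x + 2^-1) * (ln (x + 1) - ln x).
Proof.
move=> x1.
pose s : R := (2 * x + 1)^-1.
have d0 : 0 < 2 * x + 1 by lra.
have s0 : 0 < s by rewrite invr_gt0.
have s1 : s < 1 by rewrite invf_lt1; lra.
have xE : x = (1 - s) / (2 * s) by rewrite /s; field; apply/eqP; lra.
have x1E : x + 1 = (1 + s) / (2 * s) by rewrite /s; field; apply/eqP; lra.
have -> : x + 2^-1 = (2 * s)^-1 by rewrite /s; field; apply/eqP; lra.
clearbody s.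
rewrite x1E xE !ln_div ?posrE; [|lra..].
have := @ln_ratio_ge _ s ltac:(lra).
by rewrite [X in _ -> _ <= X]mulrC ler_pdivlMr; lra.
Qed.

(** The same substitution reduces the case x >= 1 to [xlnx_diff_le]; at x = 0 what remains is ln 2
    <= 1. *)
Lemma xlnx_succ_le (R : realType) (x : R) : x = 0 \/ 1 <= x ->
  (x + 1) * ln (x + 1) - x * ln x - ln (x + 2^-1) <= 1.
Proof.
case=> [->|x1].
  rewrite !add0r mul0r subr0 ln1 mulr0 lnV ?posrE// sub0r opprK.
  by rewrite -[2]/(1 + 1); apply: le_ln1Dx; lra.
pose s : R := (2 * x + 1)^-1.
have d0 : 0 < 2 * x + 1 by lra.
have s0 : 0 < s by rewrite invr_gt0.
have s1 : s < 1 by rewrite invf_lt1; lra.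
have xE : x = (1 - s) / (2 * s) by rewrite /s; field; apply/eqP; lra.
have x1E : x + 1 = (1 + s) / (2 * s) by rewrite /s; field; apply/eqP; lra.
have -> : x + 2^-1 = (2 * s)^-1 by rewrite /s; field; apply/eqP; lra.
clearbody s.
rewrite x1E {1 2}xE !ln_div ?lnV ?posrE; [|lra..].
have := @xlnx_diff_le _ s ltac:(lra).
set u := ln _; set v := ln (1 - s); set w := ln (2 * s) => h.
rewrite (_ : _ - _ - _ = ((1 + s) * u - (1 - s) * v) / (2 * s)).
  by rewrite ler_pdivrMr; lra.
by field; apply/eqP; lra.
Qed.

Definition xlnx (R : realType) (x : R) : R := x * ln x.

(* Each step [b -> b.+1] (or [a -> a.+1]) adds at least as much to the right
   side as to the left one, because (b+1)^(b+1) / (b^b (b+1/2)) <= e and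
   (1 + 1/n)^(n+1/2) >= e for n = a + b; the bound is tight at (1, 0). *)
Lemma ln_kt_ge (R : realType) a b : (0 < a + b)%N ->
  xlnx a%:R + xlnx b%:R - xlnx (a + b)%:R - ln 2 - 2^-1 * ln (a + b)%:R
    <= ln (kt R a b).
Proof.
pose P a b := xlnx (a%:R : R) + xlnx b%:R - xlnx (a + b)%:R - ln 2
   - 2^-1 * ln (a + b)%:R <= ln (kt R a b).
have PC c e : P c e -> P e c by rewrite /P => h; rewrite ktC addnC [xlnx _ + xlnx _]addrC.
have step c e : (0 < c + e)%N -> P c e -> P c e.+1.
  move=> ce0; rewrite /P ktSr addnS.
  have T1 : 1 <= (c + e)%:R :> R by rewrite ler1n.
  have e0 : e%:R = 0 :> R \/ 1 <= e%:R :> R.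
    by case: (e) => [|e']; [left|right; rewrite ler1n].
  have e0' : 0 <= e%:R :> R by [].
  rewrite lnM ?posrE ?kt_gt0 ?divr_gt0 ?ltr_wpDl//.
  rewrite [ln (_ / (c + e).+1%:R)]ln_div ?posrE ?ltr_wpDl//; set K := ln (kt _ _ _).
  have := ln_succ_ge T1; have := xlnx_succ_le e0.
  rewrite /xlnx -[e.+1%:R]natr1 -[(c + e).+1%:R]natr1; move: (c + e)%:R T1 => n n1.
  lra.
suff H c e : P c.+1 e.
  case: a => [|a] h; last exact: H.
  by apply/PC; case: b h.
elim: e => [|e ih]; last exact: step.
elim: c => [|c ih]; last by apply/PC/step => //; exact/PC.
have ktE : kt R 1 0 = 2^-1.
  by rewrite /kt big_ord_recr !big_ord0/= addn0 factS fact0; field.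
by rewrite /P ktE /xlnx addn0 ln1 lnV ?posrE//; lra.
Qed.

(** * The binary relative entropy and its inverses *)

Lemma ln_sub_le (R : realType) (x y : R) : 0 < x -> 0 < y ->
  ln y - ln x <= (y - x) / x.
Proof.
move=> x0 y0; rewrite -ln_div ?posrE//.
have -> : y / x = 1 + (y - x) / x by field; apply/eqP; lra.
apply: le_ln1Dx; have -> : (y - x) / x = y / x - 1 by field; apply/eqP; lra.
by rewrite ltrBrDl subrr divr_gt0.
Qed.

(** At p = 0 or p = 1 the logarithm of 0 carries the factor 0, so one formula covers all p in [0, 1]
    once 0 < q < 1. *)
Definition kl_fin (R : realType) (p q : R) : R :=
  p * ln (p / q) + (1 - p) * ln ((1 - p) / (1 - q)).

Lemma mul_ln_div (R : realType) (p q : R) : 0 <= p -> 0 < q ->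
  p * ln (p / q) = xlnx p - p * ln q.
Proof.
rewrite le_eqVlt => /predU1P[<-|p0] q0; first by rewrite /xlnx !mul0r subr0.
by rewrite ln_div ?posrE// mulrBr.
Qed.

Lemma kl_finE (R : realType) (p q : R) : 0 <= p <= 1 -> 0 < q < 1 ->
  kl_fin p q = xlnx p + xlnx (1 - p) - p * ln q - (1 - p) * ln (1 - q).
Proof.
move=> /andP[p0 p1] /andP[q0 q1].
by rewrite /kl_fin !mul_ln_div ?subr_gt0 ?subr_ge0//; lra.
Qed.

Lemma klE (R : realType) (p q : R) : 0 < q < 1 -> kl p q = (kl_fin p q)%:E.
Proof.
move=> /andP[q0 q1]; rewrite /kl /kl_fin.
rewrite (gt_eqF q0) (lt_eqF q1)/=.
have [->|p0] := eqVneq p 0; first by rewrite mul0r add0r subr0 !mul1r.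
have [->|p1//] := eqVneq p 1.
by rewrite subrr !mul0r addr0 !mul1r.
Qed.

Lemma kl_q1 (R : realType) (p : R) : p != 1 -> kl p 1 = +oo%E.
Proof.
move=> p1; rewrite /kl eqxx orbT (negbTE p1).
by case: ifP.
Qed.

(** The tangents at q bound the increase of p ln by q' - q, because p <= q, and that of (1 - p) ln(1
    - .) by q - q'; the two bounds cancel. *)
Lemma kl_fin_le_r (R : realType) (p q q' : R) :
  0 <= p -> p <= q -> q <= q' -> 0 < q -> q' < 1 ->
  kl_fin p q <= kl_fin p q'.
Proof.
move=> p0 pq qq' q0 q'1; rewrite !kl_finE; [|lra..].
have h1 : ln q' - ln q <= (q' - q) / q by apply: ln_sub_le; lra.
have h2 : ln (1 - q') - ln (1 - q) <= (1 - q' - (1 - q)) / (1 - q).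
  by apply: ln_sub_le; lra.
have h3 : p * (ln q' - ln q) <= q' - q.
  apply: (le_trans (ler_wpM2l p0 h1)).
  by rewrite mulrCA ler_piMr ?subr_ge0// ler_pdivrMr ?mul1r.
have h4 : (1 - p) * (ln (1 - q') - ln (1 - q)) <= q - q'.
  apply: (le_trans (ler_wpM2l _ h2)); first by lra.
  have -> : (1 - p) * ((1 - q' - (1 - q)) / (1 - q)) =
     (q - q') * ((1 - p) / (1 - q)) by field; apply/eqP; lra.
  have : 1 <= (1 - p) / (1 - q) by rewrite ler_pdivlMr; lra.
  by nra.
lra.
Qed.

Lemma kl_fin_refl (R : realType) (p : R) : 0 < p < 1 -> kl_fin p p = 0.
Proof. by move=> p01; rewrite kl_finE ?/xlnx; lra. Qed.

Lemma kl_fin_le_l (R : realType) (p p' q : R) :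
  0 <= p' -> p' <= p -> p <= q -> 0 < q < 1 -> kl_fin p q <= kl_fin p' q.
Proof.
move=> p'0 p'p pq /andP[q0 q1].
have [pe|p'lt] := eqVneq p' p; first by rewrite pe.
have p0 : 0 < p by rewrite (le_lt_trans p'0)// lt_neqAle p'lt.
have h : 0 <= kl_fin p' p.
  move: p'0; rewrite le_eqVlt => /predU1P[<-|p'0].
    rewrite /kl_fin mul0r add0r subr0 !mul1r ln_ge0// -[leLHS]invr1.
    by rewrite lef_pV2 ?posrE; lra.
  by rewrite -(@kl_fin_refl _ p') ?kl_fin_le_r; lra.
(* kl(p', q) = kl(p', p) + kl(p, q) + (p' - p) (logit p - logit q) *)
have h1 : ln p <= ln q by rewrite ler_ln ?posrE; lra.
have h2 : ln (1 - q) <= ln (1 - p) by rewrite ler_ln ?posrE; lra.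
have h3 : 0 <= (p - p') * ((ln q - ln p) + (ln (1 - p) - ln (1 - q))).
  by rewrite mulr_ge0//; lra.
move: h; rewrite !kl_finE; [|lra..]; rewrite /xlnx; lra.
Qed.

Lemma kl_refl (R : realType) (p : R) : 0 <= p <= 1 -> kl p p = 0%E.
Proof.
move=> p01; rewrite /kl; have [->|p0] := eqVneq p 0.
  by rewrite eq_sym oner_eq0 subr0 invr1 ln1.
have [->|p1] := eqVneq p 1; first by rewrite invr1 ln1.
have h : 0 < p < 1 by rewrite !lt_neqAle eq_sym p0 p1.
by rewrite -/(kl_fin p p) kl_fin_refl.
Qed.

(** Combines the monotonicity in both arguments above the diagonal. On the boundary, q' = 1 gives
    +oo unless p' = 1, which makes all four numbers 1, and q = 0 forces p = p' = 0. *)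
Lemma kl_le (R : realType) (p p' q q' : R) :
  0 <= p' -> p' <= p -> p <= q -> q <= q' -> q' <= 1 ->
  (kl p q <= kl p' q')%E.
Proof.
move=> p'0 p'p pq + q'1; move: q'1; rewrite le_eqVlt => /predU1P[->|q'1] qq'.
  have [p'1|p'1] := eqVneq p' 1; last by rewrite kl_q1 ?leey.
  rewrite p'1.
  have -> : p = 1 by lra.
  by have -> : q = 1 by lra.
have : 0 <= q by lra.
rewrite le_eqVlt => /predU1P[q0|q0]; last first.
  rewrite !klE ?lee_fin; [|lra..].
  by apply: (@le_trans _ _ (kl_fin p q')); [apply: kl_fin_le_r|apply: kl_fin_le_l]; lra.
have -> : p' = 0 by lra.
have -> : p = 0 by lra.
have : 0 <= q' by lra.
rewrite -{}q0 kl_refl ?lexx ?ler01// le_eqVlt => /predU1P[<-|q'0].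
  by rewrite kl_refl ?lexx ?ler01.
rewrite klE ?q'0// lee_fin /kl_fin mul0r add0r subr0 !mul1r ln_ge0//.
by rewrite -[leLHS]invr1 lef_pV2 ?posrE; lra.
Qed.

(** Exchanging the two outcomes; this reflection carries the results on the upper inverse to the
    lower one. *)
Lemma kl_onem (R : realType) (p q : R) : 0 <= q <= 1 ->
  kl (1 - p) (1 - q) = kl p q.
Proof.
have e0 (x : R) : (1 - x == 0) = (x == 1) by rewrite subr_eq0 eq_sym.
have e1 (x : R) : (1 - x == 1) = (x == 0).
  by rewrite -subr_eq0 addrAC subrr sub0r oppr_eq0.
move=> q01; rewrite /kl !e0 !e1 !subKr.
have [->|p1] := eqVneq p 1; first by rewrite oner_eq0.
have [//|p0] := eqVneq p 0.
by rewrite orbC; case: ifP => // _; rewrite addrC.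
Qed.

(** * Upper and lower inverses of the relative entropy *)

Section kl_inv.
Context {R : realType}.
Implicit Types (p q b : R) (C : \bar R).

Lemma kl_inv_upper_ge p q C : 0 <= q <= 1 -> (kl p q <= C)%E ->
  q <= kl_inv_upper p C.
Proof.
move=> q01 klC; apply: ub_le_sup; last by [].
by exists 1 => x /= [/andP[]].
Qed.

(** Since kl(p, p) = 0 <= C, the set contains p, so its supremum is not the default value of
    [sup]. *)
Lemma kl_inv_upper_le p b C : 0 <= p <= 1 -> (0 <= C)%E ->
  (forall q, 0 <= q <= 1 -> (kl p q <= C)%E -> q <= b) ->
  kl_inv_upper p C <= b.
Proof.
move=> p01 C0 h; apply: ge_sup; first by exists p; split; rewrite ?kl_refl.
by move=> x /= [x01]; exact: h.
Qed.

Lemma kl_inv_upper_id p C : 0 <= p <= 1 -> (0 <= C)%E -> p <= kl_inv_upper p C.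
Proof. by move=> p01 C0; apply: kl_inv_upper_ge; rewrite ?kl_refl. Qed.

Lemma kl_inv_upper_homo p p' C C' :
  0 <= p -> p <= p' -> p' <= 1 -> (0 <= C)%E -> (C <= C')%E ->
  kl_inv_upper p C <= kl_inv_upper p' C'.
Proof.
move=> p0 pp' p'1 C0 CC'; have C'0 := le_trans C0 CC'.
apply: kl_inv_upper_le => // [|q /andP[q0 q1] klC]; first by lra.
have [qp'|p'q] := leP q p'.
  by apply: (le_trans qp'); apply: kl_inv_upper_id => //; lra.
apply: kl_inv_upper_ge; first by rewrite q0.
by apply: le_trans CC'; apply: le_trans klC; apply: kl_le => //; lra.
Qed.

Lemma kl_inv_upper_pinfty p : 0 <= p <= 1 -> kl_inv_upper p +oo%E = 1.
Proof.
move=> p01; apply/eqP; rewrite eq_le; apply/andP; split.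
  by apply: kl_inv_upper_le => // q /andP[].
by apply: kl_inv_upper_ge; rewrite ?leey ?lexx ?ler01.
Qed.

(** Right continuity in the level; it serves the infimum in [upper_band], whose terms are only
    approached from one side at an observation. *)
Lemma kl_inv_upper_right_cont p b (c : R) : 0 <= p <= 1 -> 0 <= c ->
  kl_inv_upper p c%:E < b ->
  exists2 c', c < c' & kl_inv_upper p c'%:E <= b.
Proof.
move=> p01 c0 ub; have [b1|b1] := leP 1 b.
  exists (c + 1); first by lra.
  apply: (le_trans _ b1); apply: kl_inv_upper_le => // [|q /andP[]//].
  by rewrite lee_fin; lra.
have pu : p <= kl_inv_upper p c%:E by apply: kl_inv_upper_id; rewrite ?lee_fin.
have b01 : 0 < b < 1 by lra.
have cb : c < kl_fin p b.
  rewrite ltNge; apply/negP => h; move: ub; rewrite ltNge => /negP; apply.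
  by apply: kl_inv_upper_ge; rewrite ?klE ?lee_fin; lra.
(* Halfway between c and kl(p, b): kl(p, .) is nondecreasing on [p, 1], so no q > b stays below this
   level. *)
exists ((c + kl_fin p b) / 2); first by lra.
apply: kl_inv_upper_le => // [|q /andP[q0 q1] klq]; first by rewrite lee_fin; lra.
rewrite leNgt; apply/negP => bq.
have : (kl p b <= kl p q)%E by apply: kl_le => //; lra.
move=> /le_trans/(_ klq); rewrite klE// lee_fin; lra.
Qed.

Lemma kl_inv_lowerE p C : 0 <= p <= 1 -> (0 <= C)%E ->
  kl_inv_lower p C = 1 - kl_inv_upper (1 - p) C.
Proof.
move=> p01 C0; have p01' : 0 <= 1 - p <= 1 by lra.
apply/eqP; rewrite eq_le; apply/andP; split.
  rewrite lerBrDr -lerBrDl; apply: kl_inv_upper_le => // q q01.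
  rewrite -{1}(subKr 1 q) kl_onem; last by lra.
  move=> h; rewrite lerBrDl -lerBrDr; apply: ge_inf.
    by exists 0 => x /= [/andP[]].
  by split => //; lra.
apply: lb_le_inf; first by exists p; split; rewrite ?kl_refl.
move=> x /= [x01 h]; rewrite lerBlDr -lerBlDl; apply: kl_inv_upper_ge; first lra.
by rewrite kl_onem.
Qed.

Lemma kl_inv_lower_le p q C : 0 <= p <= 1 -> 0 <= q <= 1 -> (kl p q <= C)%E ->
  (0 <= C)%E -> kl_inv_lower p C <= q.
Proof.
move=> p01 q01 klC C0; rewrite kl_inv_lowerE// lerBlDr -lerBlDl.
by apply: kl_inv_upper_ge; rewrite ?kl_onem//; lra.
Qed.

Lemma kl_inv_lower_homo p p' C C' :
  0 <= p -> p <= p' -> p' <= 1 -> (0 <= C')%E -> (C' <= C)%E ->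
  kl_inv_lower p C <= kl_inv_lower p' C'.
Proof.
move=> p0 pp' p'1 C0 CC'; have C'0 := le_trans C0 CC'.
rewrite !kl_inv_lowerE ?(le_trans C0) //; [|lra..].
by rewrite lerD2l lerN2; apply: kl_inv_upper_homo => //; lra.
Qed.

End kl_inv.

(** * The confidence level as a function of the gap between thresholds *)

Section kl_level.
Context {R : realType}.
Variables (delta : R) (T : nat).
Hypotheses (delta01 : 0 < delta <= 1) (T_gt0 : (0 < T)%N).
Implicit Types h c : R.

Let delta0 : 0 < delta. Proof. by case/andP: delta01. Qed.

Let TR0 : 0 < T%:R :> R. Proof. by rewrite ltr0n. Qed.

Let sT0 : 0 < 2 * Num.sqrt T%:R :> R. Proof. by rewrite mulr_gt0 ?sqrtr_gt0. Qed.

Lemma kl_level0 : kl_level delta T 0 = +oo%E.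
Proof.
by rewrite /kl_level mul0r inve0 gt0_muley ?lte_fin//= gt0_muley ?lte_fin ?invr_gt0.
Qed.

Lemma kl_levelE h : 0 < h ->
  kl_level delta T h = (T%:R^-1 * ln (2 * Num.sqrt T%:R / (h * delta)))%:E.
Proof.
move=> h0; have hd0 : 0 < h * delta by rewrite mulr_gt0.
rewrite /kl_level inver gt_eqF// -EFinM lne_EFin ?divr_gt0//.
Qed.

Lemma kl_level_anti h h' : 0 <= h -> h <= h' ->
  (kl_level delta T h' <= kl_level delta T h)%E.
Proof.
rewrite le_eqVlt => /predU1P[<- _|h0 hh']; first by rewrite kl_level0 leey.
have h'0 : 0 < h' by lra.
rewrite !kl_levelE// lee_fin ler_wpM2l ?invr_ge0//.
rewrite ler_ln ?posrE ?divr_gt0 ?mulr_gt0 ?sqrtr_gt0//.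
by rewrite ler_pM2l// lef_pV2 ?posrE ?mulr_gt0// ler_pM2r.
Qed.

Lemma kl_level_ge0 h : 0 <= h -> h <= 1 -> (0 <= kl_level delta T h)%E.
Proof.
move=> h0 h1; apply: le_trans (kl_level_anti h0 h1).
rewrite kl_levelE// lee_fin mulr_ge0 ?invr_ge0// ln_ge0// mul1r.
case/andP: delta01 => d0 d1; rewrite ler_pdivlMr// mul1r (le_trans d1)//.
have : 1 <= Num.sqrt T%:R :> R by rewrite -[leLHS]sqrtr1 ler_wsqrtr// ler1n.
lra.
Qed.

Lemma kl_level_left_cont h c : 0 < h -> (kl_level delta T h < c%:E)%E ->
  exists2 h', 0 < h' < h & (kl_level delta T h' <= c%:E)%E.
Proof.
move=> h0; rewrite kl_levelE// lte_fin => hc.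
set L := _ * ln _ in hc.
have e1 : expR (T%:R * (L - c)) < 1.
  by rewrite -[ltRHS]expR0 ltr_expR pmulr_rlt0// subr_lt0.
have e0 := expR_gt0 (T%:R * (L - c)).
(* This gap solves the equation: its level is exactly c. *)
exists (h * expR (T%:R * (L - c))).
  by rewrite mulr_gt0//= gtr_pMr.
rewrite kl_levelE ?mulr_gt0// lee_fin.
have -> : 2 * Num.sqrt T%:R / (h * expR (T%:R * (L - c)) * delta) =
   2 * Num.sqrt T%:R / (h * delta) / expR (T%:R * (L - c)).
  by field; rewrite !gt_eqF.
rewrite ln_div ?posrE ?divr_gt0 ?mulr_gt0 ?sqrtr_gt0// expRK mulrBr -/L.
by rewrite mulKf ?gt_eqF//; lra.
Qed.

End kl_level.

(** * Order statistics *)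

Lemma emp_count_le_size (R : realType) (x : nat -> R) T z :
  (emp_count x T z <= T)%N.
Proof. by rewrite -[leqRHS](size_iota 0 T) count_size. Qed.

Lemma emp_count_homo (R : realType) (x : nat -> R) T y z : y <= z ->
  (emp_count x T y <= emp_count x T z)%N.
Proof. by move=> yz; apply: sub_count => t /= /le_trans; apply. Qed.

Lemma emp_cdf_homo (R : realType) (x : nat -> R) T y z : y <= z ->
  emp_cdf x T y <= emp_cdf x T z.
Proof. by move=> yz; rewrite ler_wpM2r ?invr_ge0// ler_nat emp_count_homo. Qed.

Lemma natr_ratio01 (R : realType) (k n : nat) : (0 < n)%N -> (k <= n)%N ->
  (0 : R) <= (k%:R / n%:R : R) <= (1 : R).
Proof.
by move=> n0 kn; rewrite divr_ge0//= ler_pdivrMr ?mul1r ?ler_nat ?ltr0n.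
Qed.

Lemma emp_cdf01 (R : realType) (x : nat -> R) T z : (0 < T)%N ->
  0 <= emp_cdf x T z <= 1.
Proof. by move=> T0; apply: natr_ratio01 => //; exact: emp_count_le_size. Qed.

Section order_statistics.
Context {R : realType}.
Variables (x : nat -> R) (T : nat).
Hypothesis x01 : forall t, 0 <= x t <= 1.

Let s : seq R := sort <=%R [seq x t | t <- iota 0 T].

Let s_sorted : sorted <=%R s. Proof. exact: sort_le_sorted. Qed.

Let size_s : size s = T. Proof. by rewrite size_sort size_map size_iota. Qed.

Let emp_countE z : emp_count x T z = count (<= z) s.
Proof. by rewrite /emp_count (permP (permEl (perm_sort _ _))) count_map. Qed.

Lemma order_stat_le t z : 0 <= z -> (t <= emp_count x T z)%N ->
  order_stat x T t <= z.
Proof.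
rewrite emp_countE /order_stat -/s; case: t => [//|t] z0 /= tc.
rewrite nth_rcons ifT; first exact: nth_count_le.
exact: leq_trans tc (count_size _ _).
Qed.

Lemma lt_order_statS t z : (emp_count x T z <= t < T)%N ->
  z < order_stat x T t.+1.
Proof.
rewrite emp_countE /order_stat -/s /= nth_rcons size_s => /andP[ct tT].
by rewrite tT; apply: nth_count_gt; rewrite // ct size_s.
Qed.

Lemma order_stat_last : order_stat x T T.+1 = 1.
Proof. by rewrite /order_stat /= nth_rcons -/s size_s ltnn eqxx. Qed.

(** At t = T the next entry is the sentinel 1, which z may equal, so the inequality of
    [lt_order_statS] becomes weak. *)
Lemma le_order_statS t z : z <= 1 -> (emp_count x T z <= t <= T)%N ->
  z <= order_stat x T t.+1.
Proof.
move=> z1 /andP[ct]; rewrite leq_eqVlt => /predU1P[->|tT].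
  by rewrite order_stat_last.
by apply/ltW/lt_order_statS; rewrite ct.
Qed.

Lemma emp_count_lt_order_stat t z : 0 <= z -> z < order_stat x T t.+1 ->
  (emp_count x T z <= t)%N.
Proof.
by move=> z0; rewrite leqNgt; apply: contraTN => /(order_stat_le z0); rewrite -leNgt.
Qed.

Lemma order_stat01 t : 0 <= order_stat x T t <= 1.
Proof.
rewrite /order_stat -/s; have [tl|tl] := ltnP t (size (0 :: rcons s 1)); last first.
  by rewrite nth_default// lexx ler01.
have := mem_nth 0 tl; rewrite inE mem_rcons inE mem_sort.
by case/or3P => [/eqP->|/eqP->|/mapP[i _ ->]//]; rewrite lexx ler01.
Qed.

Lemma emp_count_order_stat t : (t <= T)%N ->
  (t <= emp_count x T (order_stat x T t))%N.
Proof.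
case: t => // t tT; rewrite ltnNge; apply/negP => h.
by have := @lt_order_statS t (order_stat x T t.+1); rewrite h tT ltxx => /(_ isT).
Qed.

Lemma emp_cdf1 : (0 < T)%N -> emp_cdf x T 1 = 1.
Proof.
move=> T0; rewrite /emp_cdf /emp_count (_ : count _ _ = T) ?divff ?pnatr_eq0 -?lt0n//.
rewrite -[RHS](size_iota 0 T); apply/eqP; rewrite -all_count.
by apply/allP => t _; case/andP: (x01 t).
Qed.

Variable delta : R.
Hypotheses (delta01 : 0 < delta <= 1) (T_gt0 : (0 < T)%N).

Let TR0 : 0 < T%:R :> R. Proof. by rewrite ltr0n. Qed.

(** If z has count t, then z <= X_{t+1}, and replacing z by X_{t+1} in the level only lowers it:
    each term of the infimum dominates a term of the minimum. Conversely the count may jump at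
    X_{t+1}, so the term of index t is reached by thresholds approaching X_{t+1} from the left. *)
Lemma upper_bandE y : 0 <= y <= 1 ->
  upper_band delta x T y = upper_band_os delta x T y.
Proof.
move=> /andP[y0 y1]; pose f t := kl_inv_upper (t%:R / T%:R)
  (kl_level delta T (order_stat x T t.+1 - y)).
rewrite -[RHS]/(\big[Num.min/f T]_(emp_count x T y <= t < T.+1) f t).
rewrite /upper_band; set A := [set _ | z in _].
have A0 : A !=set0 by eexists; exists y => //=; rewrite in_itv/= lexx.
have lbA : has_lbound A.
  exists 0 => v [z /= + <-]; rewrite in_itv/= => /andP[yz z1].
  have /andP[F0 F1] := @emp_cdf01 _ x T z T_gt0.
  apply: (le_trans F0); apply: kl_inv_upper_id; first by rewrite F0.
  by apply: kl_level_ge0 => //; lra.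
(* The initial value of the minimum is its term t = T, attained at z = 1 because all observations
   are at most 1. *)
have fT : f T = kl_inv_upper (emp_cdf x T 1) (kl_level delta T (1 - y)).
  by rewrite /f order_stat_last emp_cdf1// divff ?gt_eqF.
apply/eqP; rewrite eq_le; apply/andP; split.
- rewrite big_nat_cond; apply: le_bigmin => [|t]; last rewrite andbT ltnS => /andP[ct tT].
    rewrite fT; apply: ge_inf => //; exists 1 => //=.
    by rewrite in_itv/= y1 lexx.
  have [->|tNT] := eqVneq t T.
    rewrite fT; apply: ge_inf => //; exists 1 => //=.
    by rewrite in_itv/= y1 lexx.
  have {}tT : (t < T)%N by rewrite ltn_neqAle tNT.
  have yX : y < order_stat x T t.+1 by apply: lt_order_statS; rewrite ct.
  have /andP[X0 X1] := order_stat01 t.+1.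
  have t01 : 0 <= (t%:R / T%:R : R) <= 1 by apply: natr_ratio01 => //; exact: ltnW.
  have l0 : (0 <= kl_level delta T (order_stat x T t.+1 - y))%E.
    by apply: kl_level_ge0 => //; lra.
  (* With slack e, raise the level to some c', then shrink the gap to some h of level at most c';
     the threshold y + h counts at most t observations. *)
  apply/ler_addgt0Pr => e e0.
  have XY0 : 0 < order_stat x T t.+1 - y by rewrite subr_gt0.
  have [c' cc' ub] : exists2 c', (kl_level delta T (order_stat x T t.+1 - y) < c'%:E)%E &
      kl_inv_upper (t%:R / T%:R) c'%:E <= f t + e.
    have fe : kl_inv_upper (t%:R / T%:R)
        (kl_level delta T (order_stat x T t.+1 - y)) < f t + e by rewrite ltrDl.
    move: l0 fe; rewrite kl_levelE// lee_fin => l0 fe.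
    by have [c' ? ?] := kl_inv_upper_right_cont t01 l0 fe; exists c'; rewrite ?lte_fin.
  have [h /andP[h0 hX] lh] := kl_level_left_cont delta01 T_gt0 XY0 cc'.
  apply: (le_trans _ ub).
  have yh : emp_cdf x T (y + h) <= t%:R / T%:R.
    rewrite ler_wpM2r ?invr_ge0// ler_nat.
    by apply: emp_count_lt_order_stat; lra.
  have /andP[F0 F1] := @emp_cdf01 _ x T (y + h) T_gt0.
  apply: (@le_trans _ _ (kl_inv_upper (emp_cdf x T (y + h)) (kl_level delta T h))).
    apply: ge_inf => //; exists (y + h).
      by rewrite /= in_itv/=; lra.
    by rewrite addrAC subrr add0r.
  apply: kl_inv_upper_homo => //; first by lra.
  by apply: kl_level_ge0 => //; lra.
- apply: lb_le_inf => // v [z /= + <-]; rewrite in_itv/= => /andP[yz z1].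
  set t := emp_count x T z.
  have tT : (t <= T)%N := emp_count_le_size _ _ _.
  have zX : z <= order_stat x T t.+1 by apply: le_order_statS; rewrite // leqnn.
  have /andP[X0 X1] := order_stat01 t.+1.
  apply: (@bigmin_inf_seq _ _ _ _ _ t) => //.
    by rewrite mem_index_iota ltnS tT emp_count_homo.
  have /andP[F0 F1] := @emp_cdf01 _ x T z T_gt0.
  apply: kl_inv_upper_homo => //; first by apply: kl_level_ge0 => //; lra.
  by apply: kl_level_anti => //; lra.
Qed.

Lemma lower_bandE y : 0 <= y <= 1 ->
  lower_band delta x T y = lower_band_os delta x T y.
Proof.
move=> /andP[y0 y1]; pose f t := kl_inv_lower (t%:R / T%:R)
  (kl_level delta T (y - order_stat x T t)).
rewrite -[RHS]/(\big[Num.max/f 0%N]_(0 <= t < (emp_count x T y).+1) f t).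
rewrite /lower_band; set A := [set _ | z in _].
have A0 : A !=set0 by eexists; exists y => //=; rewrite in_itv/= lexx y0.
have lb z : 0 <= z <= y -> kl_inv_lower (emp_cdf x T z) (kl_level delta T (y - z)) <= 1.
  move=> /andP[z0 zy].
  have F01 := @emp_cdf01 _ x T z T_gt0.
  apply: (@le_trans _ _ (emp_cdf x T z)); last by case/andP: F01.
  apply: kl_inv_lower_le => //; rewrite ?kl_refl//; apply: kl_level_ge0 => //; lra.
have ubA : has_ubound A.
  by exists 1 => v [z /= + <-]; rewrite in_itv/= => /lb.
have fA t : (t <= emp_count x T y)%N -> f t <= sup A.
  move=> ty.
  have tT : (t <= T)%N := leq_trans ty (emp_count_le_size _ _ _).
  have Xy : order_stat x T t <= y by exact: order_stat_le.
  have /andP[X0 X1] := order_stat01 t.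
  have /andP[F0 F1] := @emp_cdf01 _ x T (order_stat x T t) T_gt0.
  have /andP[t0 _] := @natr_ratio01 R _ _ T_gt0 tT.
  apply: (@le_trans _ _ (kl_inv_lower (emp_cdf x T (order_stat x T t))
    (kl_level delta T (y - order_stat x T t)))).
    apply: kl_inv_lower_homo => //; last by apply: kl_level_ge0 => //; lra.
    by rewrite ler_wpM2r ?invr_ge0// ler_nat emp_count_order_stat.
  by apply: ub_le_sup => //; exists (order_stat x T t) => //=; rewrite in_itv/= X0.
apply/eqP; rewrite eq_le; apply/andP; split; last first.
  rewrite big_nat_cond; apply: bigmax_le => [|t]; first exact: fA.
  by rewrite andbT ltnS => /fA.
apply: ge_sup => // v [z /= + <-]; rewrite in_itv/= => /andP[z0 zy].
set t := emp_count x T z.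
have tT : (t <= T)%N := emp_count_le_size _ _ _.
have Xz : order_stat x T t <= z by exact: order_stat_le.
have /andP[X0 X1] := order_stat01 t.
apply: (@bigmax_sup_seq _ _ _ _ _ t) => //.
  by rewrite mem_index_iota ltnS emp_count_homo.
have /andP[F0 F1] := @emp_cdf01 _ x T z T_gt0.
apply: kl_inv_lower_homo => //; first by apply: kl_level_ge0 => //; lra.
by apply: kl_level_anti => //; lra.
Qed.

End order_statistics.

(** * Ville's inequality on words *)

Lemma fsbig_fintype (V : Type) (idx : V) (op : Monoid.com_law idx)
    (I : finType) (D : set I) (F : I -> V) :
  \big[op/idx]_(i \in D) F i = \big[op/idx]_(i | i \in D) F i.
Proof.
rewrite (fsbigE [seq i <- index_enum I | i \in D]); first last.
- by move=> i Di; rewrite mem_filter mem_index_enum mem_set.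
- by move=> i /=; rewrite mem_filter => /andP[/set_mem].
- by rewrite filter_uniq// index_enum_uniq.
by rewrite big_filter_cond; apply: eq_bigl => i; rewrite andbb.
Qed.

Lemma measure_bigcup_ndecr_le d (T : measurableType d) (R : realType)
    (mu : {measure set T -> \bar R}) (F : (set T)^nat) (a : \bar R) :
  (forall n, measurable (F n)) -> {homo F : n m / (n <= m)%N >-> (n `<=` m)%classic} ->
  (forall n, (mu (F n) <= a)%E) -> (mu (\bigcup_n F n) <= a)%E.
Proof.
move=> mF homoF Fa.
have cF : (mu \o F) x @[x --> \oo] --> mu (\bigcup_n F n).
  apply: nondecreasing_cvg_mu => //; first exact: bigcupT_measurable.
  by move=> n m nm; apply/subsetPset; exact: homoF.
rewrite -(cvg_lim _ cF)//; apply: lime_le; first by apply/cvg_ex; exists (mu (\bigcup_n F n)).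
exact: nearW.
Qed.

Section ville.
Context d (Omega : measurableType d) (R : realType) (Pr : probability Omega R).
Variables (S : finType) (Y : nat -> Omega -> S) (p : S -> R).

Definition word T w : seq S := [seq Y t w | t <- iota 0 T].
Definition cylinder (u : seq S) : set Omega := [set w | word (size u) w = u].

Hypothesis mY : forall t a, measurable (Y t @^-1` [set a]).
Hypothesis cylinder_rcons : forall u a,
  Pr (cylinder (rcons u a)) = (Pr (cylinder u) * (p a)%:E)%E.

Lemma wordS T w : word T.+1 w = rcons (word T w) (Y T w).
Proof. by rewrite /word -addn1 iotaD map_cat cats1. Qed.

Lemma measurable_word (Q : pred (seq S)) T : measurable [set w | Q (word T w)].
Proof.
elim: T Q => [|T ih] Q.
  by case: (Q [::]) (erefl (Q [::])) => QE; [rewrite (_ : mkset _ = setT)|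
    rewrite (_ : mkset _ = set0)] => //; apply/seteqP; split=> w //=; rewrite QE.
rewrite (_ : mkset _ = \bigcup_(a in setT)
   ([set w | Q (rcons (word T w) a)] `&` Y T @^-1` [set a])).
  apply: fin_bigcup_measurable; first exact: finite_finset.
  by move=> a _; apply: measurableI; [exact: (ih (fun u => Q (rcons u a)))|exact: mY].
apply/seteqP; split=> [w /=|w [a _ [/= Qw Ya]]]; last by rewrite wordS Ya.
by rewrite wordS => Qw; exists (Y T w).
Qed.

Lemma measurable_cylinder u : measurable (cylinder u).
Proof.
rewrite (_ : cylinder u = [set w | word (size u) w == u]).
  exact: (measurable_word (pred1 u)).
by apply/seteqP; split=> w /eqP.
Qed.

Variables (W : seq S -> R) (c : R).
Hypotheses (c0 : 0 < c) (W0 : forall u, 0 <= W u).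
Hypothesis W_super : forall u, \sum_a p a * W (rcons u a) <= W u.

(** The window is m, ..., m + N - 1; its start moves with the prefix in the induction on N. *)
Let crossing m N := [set w | has (fun k => c < W (word k w)) (iota m N)].

Let measurable_crossing m N : measurable (crossing m N).
Proof.
elim: N m => [|N ih] m.
  by rewrite (_ : crossing _ _ = set0)//; apply/seteqP; split.
rewrite (_ : crossing m N.+1 = [set w | c < W (word m w)] `|` crossing m.+1 N).
  by apply: measurableU => //; exact: (measurable_word (fun u => c < W u)).
by apply/seteqP; split=> w /= /orP.
Qed.

Let Pr_fin A : measurable A -> Pr A = (fine (Pr A))%:E.
Proof. by move=> mA; rewrite fineK// fin_num_measure. Qed.

(* Backward induction: conditionally on the prefix u, the wealth process
   restarted at u crosses c with probability at most W u / c. *)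
Let crossing_cylinder N u :
  (Pr (cylinder u `&` crossing (size u) N) <=
    (fine (Pr (cylinder u)) * (W u / c))%:E)%E.
Proof.
have mC := measurable_cylinder.
elim: N u => [|N ih] u.
  rewrite (_ : crossing _ _ = set0); last by apply/seteqP; split.
  by rewrite setI0 measure0 lee_fin mulr_ge0 ?divr_ge0 ?fine_ge0 ?measure_ge0 ?W0 ?(ltW c0).
(* If W u > c, the right side is at least the mass of the cylinder. *)
have [cW|Wc] := ltP c (W u).
  apply: (@le_trans _ _ (Pr (cylinder u))).
    by apply: le_measure; rewrite ?inE; [exact: measurableI|exact: mC|exact: subIsetl].
  rewrite Pr_fin// lee_fin ler_peMr ?fine_ge0 ?measure_ge0//.
  by rewrite ler_pdivlMr// mul1r ltW.
(* Otherwise the crossing happens after time [size u], and the cylinder splits according to the next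
   letter. *)
have sub : cylinder u `&` crossing (size u) N.+1 `<=`
    \bigcup_(a in setT) (cylinder (rcons u a) `&` crossing (size (rcons u a)) N).
  move=> w [uw /= /orP[]]; first by rewrite uw ltNge Wc.
  move=> hw; exists (Y (size u) w) => //; split; last by rewrite size_rcons.
  by rewrite /cylinder/= size_rcons wordS uw.
have mG a : measurable (cylinder (rcons u a) `&` crossing (size (rcons u a)) N).
  exact: measurableI.
have := @content_sub_fsum _ _ _ Pr _ _ _ _ (@finite_finset _ setT) (fun a _ => mG a) _ sub.
move=> /(_ (measurableI _ _ (mC u) (measurable_crossing _ _))) /le_trans; apply.
rewrite fsbig_fintype/= (eq_bigl xpredT); last by move=> a; exact: mem_set.
apply: (le_trans (lee_sum _ (fun a _ => ih (rcons u a)))).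
rewrite sumEFin lee_fin.
rewrite (eq_bigr (fun a => fine (Pr (cylinder u)) * (p a * W (rcons u a)) / c)).
  rewrite -mulr_suml -mulr_sumr -mulrA ler_wpM2l ?fine_ge0 ?measure_ge0//.
  by rewrite ler_wpM2r ?invr_ge0 ?W_super// ltW.
by move=> a _; rewrite cylinder_rcons (Pr_fin (mC u)) /=; ring.
Qed.

(** The crossing events of bounded horizon increase to the full event, and the case of the empty
    prefix bounds each of them. *)
Lemma ville : measurable [set w : Omega | exists T, (c < W (word T w))%R] /\
  (Pr [set w : Omega | exists T, (c < W (word T w))%R] <= (W [::] / c)%:E)%E.
Proof.
have -> : [set w : Omega | exists T, (c < W (word T w))%R] = \bigcup_N crossing 0 N.
  apply/seteqP; split=> [w [T cT]|w [N _ /hasP[T _ cT]]]; last by exists T.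
  by exists T.+1 => //; apply/hasP; exists T => //; rewrite mem_iota/= add0n.
split; first by apply: bigcupT_measurable.
apply: measure_bigcup_ndecr_le => // [n m nm w /hasP[T + cT]|N].
  rewrite mem_iota add0n => /= Tn; apply/hasP; exists T => //.
  by rewrite mem_iota/= add0n (leq_trans Tn).
have := crossing_cylinder N [::].
rewrite (_ : cylinder [::] = setT); last by apply/seteqP; split.
by rewrite setTI probability_setT mul1r.
Qed.

End ville.

(** * The wealth process of a finite set of thresholds *)

(* Likelihood ratio of the Krichevsky-Trofimov law against Bernoulli(f) for a
   word with a ones and b zeros. Words of probability 0 get the value B, which
   plays the role of +oo. *)
Definition kt_ratio (R : realType) (B f : R) (a b : nat) : R :=
  if (f == 0) && (0 < a)%N || (f == 1) && (0 < b)%N then B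
  else kt R a b / (f ^+ a * (1 - f) ^+ b).

Lemma kt_ratio_ge0 (R : realType) (B f : R) a b : 0 <= B -> 0 <= f <= 1 ->
  0 <= kt_ratio B f a b.
Proof.
move=> B0 /andP[f0 f1]; rewrite /kt_ratio; case: ifP => // _.
by rewrite divr_ge0 ?(ltW (kt_gt0 _ _ _))// mulr_ge0 ?exprn_ge0// subr_ge0.
Qed.

Lemma kt_ratio00 (R : realType) (B f : R) : kt_ratio B f 0 0 = 1.
Proof.
rewrite /kt_ratio !andbF/= /kt !big_ord0 addn0 fact0 !expr0.
by rewrite !mulr1 invr1 !mulr1.
Qed.

Lemma kt_ratioC (R : realType) (B f : R) a b :
  kt_ratio B (1 - f) a b = kt_ratio B f b a.
Proof.
rewrite /kt_ratio subKr ktC [X in _ / X]mulrC orbC.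
by rewrite subr_eq0 [1 == f]eq_sym -subr_eq0 addrAC subrr sub0r oppr_eq0.
Qed.

(** For 0 < f < 1 equality holds by [ktD]. At f = 0 or 1 the impossible letter has weight 0 and the
    other one can only lower the ratio, hence an inequality. *)
Lemma kt_ratio_super (R : realType) (B f : R) a b : 0 <= B -> 0 <= f <= 1 ->
  f * kt_ratio B f a.+1 b + (1 - f) * kt_ratio B f a b.+1 <= kt_ratio B f a b.
Proof.
move=> B0.
have H0 c e : kt_ratio B 0 c e.+1 <= kt_ratio B 0 c e.
  rewrite /kt_ratio eqxx eq_sym oner_eq0 /= orbF; case: ifP => // _.
  rewrite subr0 !expr1n !mulr1 ler_wpM2r ?invr_ge0 ?exprn_ge0//.
  by rewrite -(ktD R c e) lerDr ltW// kt_gt0.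
move=> /andP[]; rewrite le_eqVlt => /predU1P[<- _|f0].
  by rewrite mul0r add0r subr0 mul1r H0.
rewrite le_eqVlt => /predU1P[->|f1].
  rewrite subrr mul0r addr0 mul1r.
  by rewrite -(subr0 1) !kt_ratioC H0.
have g0 : 0 < 1 - f by rewrite subr_gt0.
rewrite /kt_ratio (gt_eqF f0) (lt_eqF f1)/= -(ktD R a b).
rewrite le_eqVlt; apply/orP; left; apply/eqP.
by rewrite !exprS; field; rewrite !expf_neq0 ?gt_eqF.
Qed.

(** The exponent is the largest Bernoulli log-likelihood, reached at q = a/(a + b); mixing costs a
    factor of at most 2 sqrt(a + b). *)
Lemma kt_ge (R : realType) a b : (0 < a + b)%N ->
  expR (xlnx a%:R + xlnx b%:R - xlnx (a + b)%:R) / (2 * Num.sqrt (a + b)%:R)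
    <= kt R a b.
Proof.
move=> ab0; have n0 : 0 < (a + b)%:R :> R by rewrite ltr0n.
have s0 : 0 < Num.sqrt (a + b)%:R :> R by rewrite sqrtr_gt0.
have lns : ln (Num.sqrt (a + b)%:R) = 2^-1 * ln (a + b)%:R :> R.
  by rewrite -[in RHS](sqr_sqrtr (ltW n0)) lnXn//; lra.
rewrite -ler_ln ?posrE ?kt_gt0 ?divr_gt0 ?expR_gt0 ?mulr_gt0//.
rewrite ln_div ?posrE ?expR_gt0 ?mulr_gt0// expRK lnM ?posrE// lns.
by apply: le_trans (ln_kt_ge R ab0); lra.
Qed.

(** The likelihood under f is the largest one times exp(-T kl(k/T, f)), so [kt_ge] gives the bound.
    A real r below kl is used because kl may be +oo; in that case the ratio is B. *)
Lemma kt_ratio_ge (R : realType) (B f r : R) k T : (0 < T)%N -> (k <= T)%N ->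
  0 <= f <= 1 -> (r%:E <= kl (k%:R / T%:R) f)%E ->
  kt_ratio B f k (T - k) = B \/
  expR (T%:R * r) / (2 * Num.sqrt T%:R) <= kt_ratio B f k (T - k).
Proof.
move=> T0 kT f01 rkl.
have TR0 : 0 < T%:R :> R by rewrite ltr0n.
have s0 : 0 < (2 * Num.sqrt T%:R)^-1 :> R.
  by rewrite invr_gt0 mulr_gt0// sqrtr_gt0.
have kTT : (k + (T - k) = T)%N by rewrite subnKC.
have := @kt_ge R k (T - k); rewrite kTT => /(_ T0) ktge.
rewrite /kt_ratio; case: ifPn => [_|nj]; [by left|right].
(* At f = 0 or f = 1 the remaining words are constant, with kl = 0; hence r <= 0 and the exponential
   is at most 1. *)
move: f01 rkl nj => /andP[]; rewrite le_eqVlt => /predU1P[<- _|f0].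
  rewrite eqxx/= negb_or -leqNgt leqn0 => rkl /andP[/eqP k0 _]; subst k.
  move: rkl; rewrite mul0r kl_refl ?lexx ?ler01// lee_fin => r0.
  rewrite subr0 expr1n expr0 mulr1 divr1; apply: le_trans ktge.
  rewrite ler_wpM2r ?(ltW s0)// ler_expR subn0 /xlnx mul0r add0r subrr.
  by rewrite mulr_ge0_le0.
rewrite le_eqVlt => /predU1P[->|f1].
  rewrite oner_eq0 eqxx/= -leqNgt leqn0 subn_eq0 => rkl Tk.
  have kT' : k = T by apply/eqP; rewrite eqn_leq kT.
  subst k; move: rkl ktge; rewrite divff ?gt_eqF// kl_refl ?lexx ?ler01// lee_fin => r0.
  rewrite subnn expr0 expr1n mulr1 divr1 => ktge; apply: le_trans ktge.
  rewrite ler_wpM2r ?(ltW s0)// ler_expR /xlnx mul0r addr0 subrr.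
  by rewrite mulr_ge0_le0.
rewrite klE ?f0// lee_fin => rkl _.
have g0 : 0 < 1 - f by rewrite subr_gt0.
have d0 : 0 < f ^+ k * (1 - f) ^+ (T - k) by rewrite mulr_gt0 ?exprn_gt0.
rewrite ler_pdivlMr//; apply: le_trans ktge.
rewrite mulrAC ler_wpM2r ?(ltW s0)//.
have -> : f ^+ k * (1 - f) ^+ (T - k) =
    expR (k%:R * ln f + (T - k)%:R * ln (1 - f)).
  by rewrite expRD !mulr_natl -!lnXn// !lnK// posrE exprn_gt0.
rewrite -expRD ler_expR -lerBrDr.
apply: (@le_trans _ _ (T%:R * kl_fin (k%:R / T%:R) f)); first by rewrite ler_wpM2l// ltW.
rewrite kl_finE ?f0 ?natr_ratio01//.
have E (j : nat) : T%:R * xlnx (j%:R / T%:R) = xlnx j%:R - j%:R * ln T%:R :> R.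
  rewrite /xlnx -[in RHS]/(xlnx _) -mul_ln_div// mulrA mulrCA.
  by rewrite divff ?mulr1// gt_eqF.
have oneE : 1 - k%:R / T%:R = (T - k)%:R / T%:R :> R.
  by rewrite natrB// mulrBl divff// gt_eqF.
rewrite oneE !mulrBr mulrDr !E.
have M (j : nat) (y : R) : T%:R * (j%:R / T%:R * y) = j%:R * y.
  by field; rewrite gt_eqF.
rewrite !M /xlnx natrB//; lra.
Qed.

Section threshold_wealth.
Context d (Omega : measurableType d) (R : realType) (Pr : probability Omega R).
Variables (P : probability R R) (X : nat -> {RV Pr >-> R}).
Hypothesis X_iid : iid_with_law P X.
Variables (n : nat) (z : 'I_n -> R) (B : R).
Hypotheses (n0 : (0 < n)%N) (B0 : 0 <= B).

(** One letter records the comparisons with all thresholds at once, which leaves a finite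
    alphabet. *)
Let letter (v : R) : {ffun 'I_n -> bool} := [ffun j => v <= z j].
Let cell a : set R := [set v | letter v = a].
Let p a := fine (P (cell a)).
Let F y := fine (P `]-oo, y]%classic).
Let Y t w := letter (X t w).

Let measurable_cell a : measurable (cell a).
Proof.
rewrite (_ : cell a = \bigcap_(j in setT)
    (if a j then `]-oo, z j]%classic else ~` `]-oo, z j]%classic)).
  apply: fin_bigcap_measurable; first exact: finite_finset.
  by move=> j _; case: ifP => _; [|apply: measurableC]; exact: measurable_itv.
apply/seteqP; split=> [v va j _|v h].
  by rewrite -va /letter ffunE; case: ifPn => /=; rewrite in_itv/= => // /negP.
apply/ffunP => j; rewrite ffunE; move: (h j I).
by case: (a j) => /=; rewrite in_itv/= => // /negP/negbTE.
Qed.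

Let P_cell a : P (cell a) = (p a)%:E.
Proof. by rewrite /p fineK// fin_num_measure. Qed.

Let P_letter (Q : pred {ffun 'I_n -> bool}) :
  P [set v | Q (letter v)] = (\sum_(a | Q a) p a)%:E.
Proof.
rewrite (_ : mkset _ = \bigcup_(a in [set a | Q a]) cell a).
  rewrite measure_fin_bigcup.
  - rewrite fsbig_fintype -sumEFin; apply: eq_big => [a|a _]; last exact: P_cell.
    by apply/idP/idP => [/set_mem|/mem_set].
  - exact: finite_finset.
  - by move=> a b _ _ [v [av bv]]; rewrite -av -bv.
  - by move=> a _; exact: measurable_cell.
by apply/seteqP; split=> [v Qv|v [a Qa va]]; [exists (letter v)|rewrite /= va].
Qed.

Let measurable_Y t a : measurable (Y t @^-1` [set a]).
Proof.
have := measurable_funP (X t) measurableT _ (measurable_cell a).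
by rewrite setTI.
Qed.

Let Pr_cylinder u : Pr (cylinder Y u) = (\prod_(a <- u) (p a)%:E)%E.
Proof.
have [a0 _] : exists a0 : {ffun 'I_n -> bool}, True by exists [ffun=> true].
case: X_iid => indep law.
rewrite (_ : cylinder Y u =
    \bigcap_(i in [set` iota 0 (size u)]) (X i @^-1` cell (nth a0 u i))).
  have -> := indep (iota 0 (size u)) (fun i => cell (nth a0 u i))
    (iota_uniq _ _) (fun i _ => measurable_cell _).
  rewrite (big_nth a0) /index_iota subn0.
  by apply: eq_bigr => i _; rewrite -P_cell -(law i).
apply/seteqP; split=> [w uw i /=|w h].
  by rewrite mem_iota/= add0n => iu; rewrite /cell/= -uw (nth_map 0%N) ?size_iota// nth_iota.
apply: (@eq_from_nth _ a0); rewrite size_map size_iota// => i iu.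
rewrite (nth_map 0%N) ?size_iota// nth_iota// add0n.
by apply: (h i); rewrite /= mem_iota add0n.
Qed.

Let cylinder_rcons_Y u a :
  Pr (cylinder Y (rcons u a)) = (Pr (cylinder Y u) * (p a)%:E)%E.
Proof. by rewrite !Pr_cylinder big_rcons. Qed.

Let F01 y : 0 <= F y <= 1.
Proof.
rewrite /F; have h : measurable `]-oo, y]%classic by exact: measurable_itv.
rewrite fine_ge0 ?measure_ge0//= -lee_fin fineK ?fin_num_measure//.
exact: probability_le1.
Qed.

Let p_true j : \sum_(a : {ffun 'I_n -> bool} | a j) p a = F (z j).
Proof.
rewrite /F (_ : `]-oo, z j]%classic = [set v | letter v j]).
  by rewrite (P_letter (fun a => a j)).
by apply/seteqP; split=> v /=; rewrite in_itv/= ffunE.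
Qed.

Let p_false j : \sum_(a : {ffun 'I_n -> bool} | ~~ a j) p a = 1 - F (z j).
Proof.
have : \sum_a p a = 1.
  apply: EFin_inj; rewrite -(P_letter predT) (_ : mkset _ = setT) ?probability_setT//.
  by apply/seteqP; split.
by rewrite (bigID (fun a : {ffun _ -> _} => a j))/= p_true => <-; rewrite addrAC subrr add0r.
Qed.

Let ratio j (u : seq {ffun 'I_n -> bool}) :=
  kt_ratio B (F (z j)) (count (fun a : {ffun 'I_n -> bool} => a j) u)
    (count (fun a : {ffun 'I_n -> bool} => ~~ a j) u).

(** Grouping the letters by coordinate j leaves a Bernoulli step with weights F(z j) and 1 - F(z
    j). *)
Let ratio_super j u : \sum_a p a * ratio j (rcons u a) <= ratio j u.
Proof.
have cr (Q : pred {ffun 'I_n -> bool}) a : count Q (rcons u a) = (count Q u + Q a)%N.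
  by rewrite -cats1 count_cat/= addn0.
rewrite (bigID (fun a : {ffun _ -> _} => a j))/=.
apply: le_trans (kt_ratio_super (count (fun a : {ffun 'I_n -> bool} => a j) u)
  (count (fun a : {ffun 'I_n -> bool} => ~~ a j) u) B0 (F01 (z j))).
rewrite -{1}p_true -p_false !mulr_suml; apply: lerD; apply: ler_sum => a aj.
  by rewrite /ratio !cr aj addn0 addn1.
by rewrite /ratio !cr aj (negbTE aj) addn0 addn1.
Qed.

(** Supermartingales for the same letters may be averaged, however dependent the coordinates are;
    the average starts at 1, so [ville] gives 1/c. *)
Lemma threshold_wealth_ville (c : R) : 0 < c ->
  let bad := [set w : Omega | exists T, (c < n%:R^-1 * \sum_j
    kt_ratio B (fine (P `]-oo, z j]%classic)) (emp_count (X ^~ w) T (z j))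
      (T - emp_count (X ^~ w) T (z j)))%R] in
  measurable bad /\ (Pr bad <= (c^-1)%:E)%E.
Proof.
move=> c0 /=.
pose W u := n%:R^-1 * \sum_j ratio j u.
have W0 u : 0 <= W u.
  by rewrite mulr_ge0 ?invr_ge0// sumr_ge0// => j _; exact: kt_ratio_ge0.
have Wsuper u : \sum_a p a * W (rcons u a) <= W u.
  rewrite (eq_bigr (fun a => n%:R^-1 * \sum_j p a * ratio j (rcons u a))); last first.
    by move=> a _; rewrite /W mulrCA mulr_sumr.
  rewrite -mulr_sumr exchange_big/= ler_wpM2l ?invr_ge0//.
  by apply: ler_sum => j _; exact: ratio_super.
have W1 : W [::] = 1.
  rewrite /W (eq_bigr (fun=> 1)); last by move=> j _; exact: kt_ratio00.
  by rewrite sumr_const card_ord mulVf// pnatr_eq0 -lt0n.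
have := ville measurable_Y cylinder_rcons_Y c0 W0 Wsuper.
rewrite W1 div1r.
have onesE w T j : count (fun a : {ffun 'I_n -> bool} => a j) (word Y T w) =
    emp_count (X ^~ w) T (z j).
  by rewrite /word count_map; apply: eq_count => t /=; rewrite ffunE.
have zerosE w T j : count (fun a : {ffun 'I_n -> bool} => ~~ a j) (word Y T w) =
    (T - emp_count (X ^~ w) T (z j))%N.
  rewrite -onesE -[X in (X - _)%N](size_iota 0 T) -(size_map (Y ^~ w)).
  by rewrite -(count_predC (fun a : {ffun 'I_n -> bool} => a j)) addKn.
have WE w T : W (word Y T w) = n%:R^-1 * \sum_j
    kt_ratio B (F (z j)) (emp_count (X ^~ w) T (z j))
      (T - emp_count (X ^~ w) T (z j)).
  by congr (_ * _); apply: eq_bigr => j _; rewrite /ratio onesE zerosE.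
rewrite (_ : [set w | exists T, _] = [set w : Omega | exists T, (c < n%:R^-1 * \sum_j
    kt_ratio B (F (z j)) (emp_count (X ^~ w) T (z j))
      (T - emp_count (X ^~ w) T (z j)))%R])//.
by apply/seteqP; split=> w [T cT]; exists T; rewrite ?WE// -WE.
Qed.

End threshold_wealth.

(** * From wealth to confidence bands *)

(** At least (b - a)(n + 1) - 1 grid points lie in [a, b]; the lost step vanishes as the grid is
    refined. *)
Lemma grid_average_ge (R : realType) (n : nat) (g : 'I_n.+1 -> R) (a b v : R) :
  0 <= a -> a <= b -> b <= 1 -> 0 <= v -> (forall j, 0 <= g j) ->
  (forall j : 'I_n.+1, a <= j.+1%:R / n.+1%:R <= b -> v <= g j) ->
  (b - a - n.+1%:R^-1) * v <= n.+1%:R^-1 * \sum_j g j.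
Proof.
move=> a0 ab b1 v0 g0; have Ni0 : 0 < n.+1%:R^-1 :> R by rewrite invr_gt0.
have Ni1 : n.+1%:R * n.+1%:R^-1 = 1 :> R by rewrite divff.
move: (n.+1%:R^-1) Ni0 Ni1 => i i0 i1 gv.
have [ba|ab'] := leP (b - i) a.
  apply: (@le_trans _ _ 0); last by rewrite mulr_ge0 ?sumr_ge0// ltW.
  by rewrite mulr_le0_ge0// addrAC subr_le0.
(* With i = 1/(n+1), the length b - a - i is recovered by telescoping the grid
   projected onto [a, b - i], which only moves at steps ending in [a, b]. *)
pose phi (x : R) := Num.max a (Num.min x (b - i)).
have step (j : 'I_n.+1) :
    (phi (j.+1%:R * i) - phi (j%:R * i)) * v <= i * g j.
  have jE : j.+1%:R * i = j%:R * i + i by rewrite -natr1 mulrDl mul1r.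
  have gj := g0 j; have := gv j; rewrite jE.
  move: (j%:R * i) => y gvj.
  have [ya|ay] := leP (y + i) a.
    have E x : x <= a -> phi x = a.
      by move=> xa; rewrite /phi min_l ?max_l// (le_trans xa)// ltW.
    by rewrite !E ?subrr ?mul0r ?mulr_ge0// ?ltW//; lra.
  have [yb|by_] := leP (y + i) b; last first.
    have E x : b - i <= x -> phi x = b - i.
      by move=> bx; rewrite /phi min_r ?max_r// ltW.
    by rewrite !E ?subrr ?mul0r ?mulr_ge0// ?ltW//; lra.
  have vg : v <= g j by apply: gvj; rewrite yb ltW.
  have h : phi (y + i) - phi y <= i.
    rewrite /phi; case: (leP y (b - i)) => h1;
      case: (leP (y + i) (b - i)) => h2;
      do ?[case: (leP a _) => ?]; lra.
  by apply: le_trans (ler_wpM2r v0 h) _; rewrite ler_wpM2l// ltW.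
rewrite mulr_sumr.
apply: le_trans (ler_sum _ (fun j _ => step j)).
rewrite -mulr_suml -(big_mkord xpredT (fun j => phi (j.+1%:R * i) - phi (j%:R * i))).
rewrite (telescope_sumr (fun j => phi (j%:R * i)))// i1 mul0r.
rewrite ler_wpM2r// /phi.
rewrite min_r; last by lra.
rewrite max_r; last by lra.
by rewrite min_l ?max_l; lra.
Qed.

Section kl_band.
Context {R : realType}.
Variables (delta : R) (F : R -> R) (x : nat -> R) (T : nat).
Hypotheses (delta01 : 0 < delta <= 1) (T_gt0 : (0 < T)%N).
Hypotheses (F01 : forall y, 0 <= F y <= 1) (F_homo : {homo F : y z / y <= z}).

(** The stand-in for +oo, (n + 1)(1/delta + 1), is chosen so that a single impossible word already
    lifts the average above 1/delta. *)
Definition grid_wealth (n : nat) : R :=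
  n.+1%:R^-1 * \sum_(j < n.+1)
    kt_ratio (n.+1%:R * (delta^-1 + 1)) (F (j.+1%:R / n.+1%:R))
      (emp_count x T (j.+1%:R / n.+1%:R))
      (T - emp_count x T (j.+1%:R / n.+1%:R)).

Hypothesis wealth_le :
  forall m, exists2 n, (m <= n)%N & grid_wealth n <= delta^-1.

Let delta0 : 0 < delta. Proof. by case/andP: delta01. Qed.

Let dV0 : 0 < delta^-1. Proof. by rewrite invr_gt0. Qed.

Let s0 : 0 < 2 * Num.sqrt T%:R :> R.
Proof. by rewrite mulr_gt0// sqrtr_gt0 ltr0n. Qed.

(** If the claim failed, every fine enough grid would have wealth above 1/delta by
    [grid_average_ge], against [wealth_le]. *)
Lemma wealth_le_kl_level (a b p q : R) : 0 <= a -> a < b -> b <= 1 ->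
  (forall t, a <= t <= b -> (kl p q <= kl (emp_cdf x T t) (F t))%E) ->
  (kl p q <= kl_level delta T (b - a))%E.
Proof.
move=> a0 ab b1 klab.
have ba0 : 0 < b - a by rewrite subr_gt0.
have TR0 : 0 < T%:R :> R by rewrite ltr0n.
(* Real minorants r also exclude kl = +oo, where r may be taken as the bound plus 1. *)
suff H r : (r%:E <= kl p q)%E ->
    r <= T%:R^-1 * ln (2 * Num.sqrt T%:R / ((b - a) * delta)).
  rewrite kl_levelE//; move: H; case: (kl p q) => [k||] H.
  - by rewrite lee_fin H.
  - have := H (T%:R^-1 * ln (2 * Num.sqrt T%:R / ((b - a) * delta)) + 1) (leey _).
    by rewrite gerDl ler10.
  - exact: leNye.
move=> rkl; set v := expR (T%:R * r) / (2 * Num.sqrt T%:R).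
have v0 : 0 < v by rewrite divr_gt0 ?expR_gt0.
suff bav : (b - a) * v <= delta^-1.
  rewrite [leRHS]mulrC ler_pdivlMr// [leLHS]mulrC.
  have bd0 : 0 < (b - a) * delta by rewrite mulr_gt0.
  rewrite -ler_expR lnK ?posrE; last by rewrite divr_gt0.
  rewrite ler_pdivlMr//.
  have -> : expR (T%:R * r) = v * (2 * Num.sqrt T%:R) by rewrite divfK ?gt_eqF.
  move: bav; rewrite -div1r ler_pdivlMr// => bav.
  rewrite (_ : v * _ * _ = (b - a) * v * delta * (2 * Num.sqrt T%:R)); last by ring.
  by rewrite ler_piMl// ltW.
rewrite leNgt; apply/negP => hv.
(* A mesh below this slack keeps (b - a - mesh) v above 1/delta. *)
have e0 : 0 < ((b - a) * v - delta^-1) / v by rewrite divr_gt0// subr_gt0.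
have [m hm] : exists m : nat, m.+1%:R^-1 < ((b - a) * v - delta^-1) / v.
  by have [m _ hm] := near_infty_natSinv_lt (PosNum e0); exists m; apply: hm => /=.
have [n mn] := wealth_le m; rewrite leNgt => /negP; apply.
pose N : R := n.+1%:R.
have N0 : 0 < N^-1 :> R by rewrite invr_gt0 ltr0n.
have Nm : N^-1 <= m.+1%:R^-1 :> R by rewrite lef_pV2 ?posrE// ?ltr0n// ler_nat.
have B0 : 0 <= N * (delta^-1 + 1) by rewrite mulr_ge0// addr_ge0// ltW.
have g0 (j : 'I_n.+1) : 0 <= kt_ratio (N * (delta^-1 + 1)) (F (j.+1%:R / N))
     (emp_count x T (j.+1%:R / N)) (T - emp_count x T (j.+1%:R / N)).
  exact: kt_ratio_ge0.
have [[j jB]|noB] := pselect (exists j : 'I_n.+1,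
    kt_ratio (N * (delta^-1 + 1)) (F (j.+1%:R / N))
     (emp_count x T (j.+1%:R / N)) (T - emp_count x T (j.+1%:R / N)) =
    N * (delta^-1 + 1)).
  apply: (@lt_le_trans _ _ (N^-1 * (N * (delta^-1 + 1)))).
    by rewrite mulKf ?gt_eqF ?ltr0n// ltrDl.
  rewrite /grid_wealth -/N ler_wpM2l ?(ltW N0)// (bigD1 j)//= jB lerDl.
  by apply: sumr_ge0 => i _.
apply: (@lt_le_trans _ _ ((b - a - N^-1) * v)).
  move: hm; rewrite ltr_pdivlMr// => hm.
  rewrite mulrBl ltrBrDl -ltrBrDr; apply: le_lt_trans hm.
  by rewrite ler_wpM2r// ltW.
apply: grid_average_ge => //; [exact: ltW|exact: ltW|move=> j jab].
have rt : (r%:E <= kl (emp_cdf x T (j.+1%:R / N)) (F (j.+1%:R / N)))%E.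
  exact: le_trans rkl (klab _ jab).
have [jB|//] := kt_ratio_ge (N * (delta^-1 + 1)) T_gt0
  (emp_count_le_size x T _) (F01 _) rt.
by case: noB; exists j.
Qed.

Lemma le_upper_band y : 0 <= y <= 1 -> F y <= upper_band delta x T y.
Proof.
move=> /andP[y0 y1]; apply: lb_le_inf.
  by eexists; exists y => //=; rewrite in_itv/= lexx.
move=> v [z /= + <-]; rewrite in_itv/= => /andP[yz z1].
have /andP[E0 E1] := @emp_cdf01 _ x T z T_gt0.
have l0 : (0 <= kl_level delta T (z - y))%E by apply: kl_level_ge0 => //; lra.
have [FE|EF] := leP (F y) (emp_cdf x T z).
  by apply: (le_trans FE); apply: kl_inv_upper_id => //; rewrite E0.
have /andP[Fy0 Fy1] := F01 y.
move: yz l0; rewrite le_eqVlt => /predU1P[<- _|yz l0].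
  by rewrite subrr kl_level0// kl_inv_upper_pinfty// emp_cdf01.
apply: kl_inv_upper_ge; first by rewrite Fy0.
(* Between y and z one has F_T(t) <= F_T(z) < F(y) <= F(t). *)
apply: wealth_le_kl_level => // t /andP[yt tz].
have /andP[Et0 Et1] := @emp_cdf01 _ x T t T_gt0; have /andP[_ Ft1] := F01 t.
apply: kl_le => //; [exact: emp_cdf_homo|exact: ltW|exact: F_homo].
Qed.

Lemma lower_band_le y : 0 <= y <= 1 -> lower_band delta x T y <= F y.
Proof.
move=> /andP[y0 y1]; apply: ge_sup.
  by eexists; exists y => //=; rewrite in_itv/= lexx y0.
move=> v [z /= + <-]; rewrite in_itv/= => /andP[z0 zy].
have E01 := @emp_cdf01 _ x T z T_gt0; have /andP[E0 E1] := E01.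
have l0 : (0 <= kl_level delta T (y - z))%E by apply: kl_level_ge0 => //; lra.
have /andP[Fy0 Fy1] := F01 y.
have [EF|FE] := leP (emp_cdf x T z) (F y).
  apply: (le_trans _ EF); apply: kl_inv_lower_le => //.
  by rewrite kl_refl.
apply: kl_inv_lower_le => //.
move: zy l0; rewrite le_eqVlt => /predU1P[-> _|zy l0].
  by rewrite subrr kl_level0// leey.
apply: wealth_le_kl_level => // t /andP[zt ty].
have /andP[Et0 Et1] := @emp_cdf01 _ x T t T_gt0; have /andP[Ft0 Ft1] := F01 t.
have := emp_cdf_homo x T zt; have := F_homo ty => Fty Ezt.
(* Here F(t) <= F(y) < F_T(z) <= F_T(t), so the arguments are reflected to fit the order in
   [kl_le]. *)
rewrite -(kl_onem _ (F01 y)) -(kl_onem (emp_cdf x T t) (F01 t)).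
by apply: kl_le; lra.
Qed.

End kl_band.

Theorem mainTheorem2 (R : realType) (P : probability R R)
    (P01 : P `[0, 1]%classic = 1%E)
    (d : measure_display) (Omega : measurableType d) (Pr : probability Omega R)
    (X : nat -> {RV Pr >-> R})
    (X01 : forall (t : nat) (w : Omega), 0 <= X t w <= 1)
    (X_iid : iid_with_law P X)
    (delta : R) (delta01 : 0 < delta <= 1) :
  (exists E : set Omega,
     [/\ measurable E,
         ((1 - delta)%:E <= Pr E)%E
       & forall (w : Omega), E w ->
         forall (T : nat) (y : R), (1 <= T)%N -> 0 <= y <= 1 ->
           lower_band delta (X ^~ w) T y <= fine (P `]-oo, y]%classic)
             <= upper_band delta (X ^~ w) T y]) /\
  (forall (w : Omega) (T : nat) (y : R), (1 <= T)%N -> 0 <= y <= 1 ->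
     upper_band delta (X ^~ w) T y = upper_band_os delta (X ^~ w) T y /\
     lower_band delta (X ^~ w) T y = lower_band_os delta (X ^~ w) T y).
Proof.
have [d0 d1] := andP delta01.
pose F y := fine (P `]-oo, y]%classic).
have mF y : measurable (`]-oo, y]%classic : set R) by exact: measurable_itv.
have F01 y : 0 <= F y <= 1.
  rewrite /F fine_ge0 ?measure_ge0//= -lee_fin fineK ?fin_num_measure//.
  exact: probability_le1.
have F_homo : {homo F : y z / y <= z}.
  move=> y z yz; rewrite /F fine_le ?fin_num_measure//.
  apply: le_measure; rewrite ?inE//.
  by apply: subset_itvl; rewrite bnd_simp.
split; last first.
  by move=> w T y T0 y01; rewrite upper_bandE// lower_bandE.
pose bad n := [set w : Omega | exists T, delta^-1 < grid_wealth delta F (X ^~ w) T n].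
have bad_ville n : measurable (bad n) /\ (Pr (bad n) <= delta%:E)%E.
  have B0 : 0 <= n.+1%:R * (delta^-1 + 1) by rewrite mulr_ge0// addr_ge0// invr_ge0 ltW.
  have dV0 : 0 < delta^-1 by rewrite invr_gt0.
  have := threshold_wealth_ville X_iid (fun j : 'I_n.+1 => j.+1%:R / n.+1%:R)
    (ltn0Sn n) B0 dV0.
  by rewrite invrK.
(* These events increase with m and each lies in [bad m], so their union has probability at most
   delta without any sum over grids. *)
pose always_bad m := \bigcap_(n in [set n | (m <= n)%N]) bad n.
have m_always m : measurable (always_bad m).
  by apply: bigcap_measurable => [|n _]; [exists m => /=|case: (bad_ville n)].
have mU : measurable (\bigcup_m always_bad m) by exact: bigcupT_measurable.
exists (~` \bigcup_m always_bad m); split.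
- exact: measurableC.
- rewrite probability_setC// EFinB leeB//.
  apply: measure_bigcup_ndecr_le => // [m n mn w wm k nk|m].
    by apply: wm => /=; exact: leq_trans nk.
  have [mbad] := bad_ville m; apply: le_trans.
  by apply: le_measure; rewrite ?inE// => w; apply => /=.
- move=> w notbad T y T0 y01.
  (* Outside the union, arbitrarily fine grids are good. *)
  have wealth_le m : exists2 n, (m <= n)%N & grid_wealth delta F (X ^~ w) T n <= delta^-1.
    apply: contrapT => h; apply: notbad; exists m => // n mn; exists T.
    by rewrite ltNge; apply/negP => wn; apply: h; exists n.
  have lu := le_upper_band delta01 T0 F01 F_homo wealth_le y01.
  have ll := lower_band_le delta01 T0 F01 F_homo wealth_le y01.
  by rewrite ll.
Qed.
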